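(* Let $c,d\in\mathbb{R}$, not both zero, and let $\alpha^*=\alpha+\lambda N$ be an $N$-$P^*$ associated curve of $\alpha$ (with respect to $c,d$). Then the Frenet frames are related by $$T^*=\frac{1-\lambda\kappa}{\sqrt{(1-\lambda\kappa)^2+(\lambda\tau)^2}}\,T+\frac{\lambda\tau}{\sqrt{(1-\lambda\kappa)^2+(\lambda\tau)^2}}\,B,$$ $$N^*=\frac{1}{\sqrt{c^2+d^2}}\left(\frac{d\lambda\tau}{\sqrt{(1-\lambda\kappa)^2+(\lambda\tau)^2}}\,T+c\,N-\frac{d(1-\lambda\kappa)}{\sqrt{(1-\lambda\kappa)^2+(\lambda\tau)^2}}\,B\right),$$ $$B^*=\frac{d}{\sqrt{c^2+d^2}}\left(-\frac{\tau(\lambda\tau^2+\kappa^2\lambda-\kappa)}{\lambda\tau\kappa'-\kappa\tau'\lambda+\tau'}\,T+N+\frac{(\lambda\kappa-1)(\lambda\tau^2+\kappa^2\lambda-\kappa)}{\lambda(-\lambda\tau\kappa'+\kappa\tau'\lambda-\tau')}\,B\right),$$ the last formula being understood where its denominators do not vanish.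
   Context: $\alpha$ is a smooth curve in $E^3$ parametrized by arc length $s$, with Frenet frame $\{T,N,B\}$, curvature $\kappa>0$ and torsion $\tau$: $T'=\kappa N$, $N'=-\kappa T+\tau B$, $B'=-\tau N$. For a curve $\alpha^*$ with the same parameter $s$ (regular, not necessarily unit speed, with ${\alpha^*}'\wedge{\alpha^*}''\ne 0$), $T^*={\alpha^*}'/\|{\alpha^*}'\|$, $B^*=({\alpha^*}'\wedge{\alpha^*}'')/\|{\alpha^*}'\wedge{\alpha^*}''\|$, $N^*=B^*\wedge T^*$. For real constants $c,d$ put $P^*=\frac{cN^*+dB^*}{\sqrt{c^2+d^2}}$ (unit vector in the normal plane of $\alpha^*$). The curve $\alpha^*$ is called an $N$-$P^*$ associated curve of $\alpha$ if $\alpha^*=\alpha+\lambda N$ for a smooth real function $\lambda$ of $s$ and $N$ is linearly dependent with $P^*$, normalized so that $N=P^*$. *)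

(* Defs.v *)
From HB Require Import structures.
From mathcomp Require Import all_boot all_order all_algebra.
From mathcomp Require Import all_classical all_reals all_analysis.

Set Implicit Arguments.
Unset Strict Implicit.
Unset Printing Implicit Defensive.

Import Order.TTheory GRing.Theory Num.Theory.
Import numFieldNormedType.Exports.

Local Open Scope classical_set_scope.
Local Open Scope ring_scope.

Section EuclideanSpace.
Variable R : realType.
Implicit Types u v : 'rV[R]_3.

Definition dotmul u v : R := (u *m v^T) 0 0.

(* The library norm on 'rV[R]_3 is the sup norm, hence this separate Euclidean
   norm.  Both induce the same topology, so derivatives are unaffected. *)
Definition enorm u : R := Num.sqrt (dotmul u u).

(* The indices j + 1 and j + 2 are computed modulo 3. *)
Definition crossmul u v : 'rV[R]_3 :=
  \row_(j < 3) (u 0 (j + 1) * v 0 (j + 2) - u 0 (j + 2) * v 0 (j + 1)).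

End EuclideanSpace.

Section Curves.
Variable R : realType.
Implicit Types (I : set R) (alpha beta : R -> 'rV[R]_3).

Definition open_interval I := [/\ open I, is_interval I & I !=set0].

(* The set I is meant to be open: f is then infinitely differentiable on I, and
   the values of f outside I are irrelevant. *)
Definition smooth_on (V : normedModType R) I (f : R -> V) :=
  forall (n : nat) (s : R), I s -> derivable (derive1n n f) s 1.

Definition regular_curve I alpha :=
  [/\ smooth_on I alpha,
      forall s, I s -> derive1 alpha s != 0 &
      forall s, I s -> crossmul (derive1 alpha s) (derive1n 2 alpha s) != 0].

Definition tangent alpha (s : R) : 'rV[R]_3 :=
  (enorm (derive1 alpha s))^-1 *: derive1 alpha s.

Definition binormal alpha (s : R) : 'rV[R]_3 :=
  (enorm (crossmul (derive1 alpha s) (derive1n 2 alpha s)))^-1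
    *: crossmul (derive1 alpha s) (derive1n 2 alpha s).

Definition normal alpha (s : R) : 'rV[R]_3 :=
  crossmul (binormal alpha s) (tangent alpha s).

(* The next two definitions are for curves parametrized by arc length; they are
   the coefficients in the Frenet equations T' = kappa N (with kappa > 0) and
   B' = - tau N. *)
Definition curvature alpha (s : R) : R := enorm (derive1 (tangent alpha) s).

Definition torsion alpha (s : R) : R :=
  - dotmul (derive1 (binormal alpha) s) (normal alpha s).

Definition arclength_frenet_curve I alpha :=
  [/\ smooth_on I alpha,
      forall s, I s -> enorm (derive1 alpha s) = 1 &
      forall s, I s -> 0 < curvature alpha s].

Definition Pvector (c d : R) beta (s : R) : 'rV[R]_3 :=
  (Num.sqrt (c ^+ 2 + d ^+ 2))^-1 *: (c *: normal beta s + d *: binormal beta s).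

(* beta = alpha + lam N is an N-P* associated curve of alpha, where the linear
   dependence of N and P* is normalized to N = P*. *)
Definition NP_associated I (c d : R) alpha (lam : R -> R) beta :=
  [/\ smooth_on I lam,
      regular_curve I beta,
      forall s, I s -> beta s = alpha s + lam s *: normal alpha s &
      forall s, I s -> normal alpha s = Pvector c d beta s].

End Curves.

(* Main.v *)
(* Since P* is normal to beta, N = P* gives <N, beta'> = lambda' = 0, so that
   beta' = (1 - lambda kappa) T + lambda tau B, which determines T*.  As
   T*, N*, B* is an orthonormal frame, solving N = P* gives
   N* = (c N - d T* x N) / sqrt (c^2 + d^2).  Finally B* is proportional to
   beta' x beta'', and the factor is fixed by <N, B*> = d / sqrt (c^2 + d^2). *)
Require Import Defs.
From HB Require Import structures.
From mathcomp Require Import all_boot all_order all_algebra.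
From mathcomp Require Import all_classical all_reals all_analysis.
From mathcomp Require Import ring.

Import Order.TTheory GRing.Theory Num.Theory.
Import numFieldNormedType.Exports.

Local Open Scope classical_set_scope.
Local Open Scope ring_scope.

Set Implicit Arguments.
Unset Strict Implicit.

(** * Coordinates of vectors with three entries *)

Lemma forall_ord3 (P : 'I_3 -> Prop) : P 0 -> P 1 -> P 2 -> forall j, P j.
Proof.
move=> P0 P1 P2 [[|[|[|j]]] hj] //.
- by have -> : Ordinal hj = 0 by exact: val_inj.
- by have -> : Ordinal hj = 1 by exact: val_inj.
- by have -> : Ordinal hj = 2 by exact: val_inj.
Qed.

Section Coordinates.
Variable R : realType.
Implicit Types u v : 'rV[R]_3.

Lemma eq_row3 u v : u 0 0 = v 0 0 -> u 0 1 = v 0 1 -> u 0 2 = v 0 2 -> u = v.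
Proof. by move=> h0 h1 h2; apply/rowP; exact: forall_ord3. Qed.

Lemma dotmulE u v : dotmul u v = u 0 0 * v 0 0 + u 0 1 * v 0 1 + u 0 2 * v 0 2.
Proof.
rewrite /dotmul mxE !big_ord_recl big_ord0 !mxE addr0 addrA.
by congr (_ + u 0 _ * v 0 _ + u 0 _ * v 0 _); exact: val_inj.
Qed.

Lemma crossmulE u v :
  (crossmul u v 0 0 = u 0 1 * v 0 2 - u 0 2 * v 0 1) *
  (crossmul u v 0 1 = u 0 2 * v 0 0 - u 0 0 * v 0 2) *
  (crossmul u v 0 2 = u 0 0 * v 0 1 - u 0 1 * v 0 0).
Proof.
by do !split; rewrite mxE; congr (u 0 _ * v 0 _ - u 0 _ * v 0 _);
  exact: val_inj.
Qed.

End Coordinates.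

(** Reduces an identity between vectors or scalars to polynomial identities in the coordinates. The
    [try] makes it serve scalar goals too, where [eq_row3] does not apply. *)
Ltac vector_ring :=
  try apply: eq_row3; rewrite ?(dotmulE, crossmulE, mxE); ring.

(** * Algebra of the dot and cross products, and orthonormal pairs *)

Section VectorAlgebra.
Variable R : realType.
Implicit Types (a : R) (u v w : 'rV[R]_3).

Lemma dotmulC u v : dotmul u v = dotmul v u. Proof. vector_ring. Qed.
Lemma dotmulDr u v w : dotmul u (v + w) = dotmul u v + dotmul u w.
Proof. vector_ring. Qed.
Lemma dotmulZr a u v : dotmul u (a *: v) = a * dotmul u v.
Proof. vector_ring. Qed.
Lemma dotmulDl u v w : dotmul (u + v) w = dotmul u w + dotmul v w.
Proof. vector_ring. Qed.
Lemma dotmulZl a u v : dotmul (a *: u) v = a * dotmul u v.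
Proof. vector_ring. Qed.

Lemma crossmulC u v : crossmul u v = - crossmul v u. Proof. vector_ring. Qed.
Lemma crossmulDr u v w : crossmul u (v + w) = crossmul u v + crossmul u w.
Proof. vector_ring. Qed.
Lemma crossmulZr a u v : crossmul u (a *: v) = a *: crossmul u v.
Proof. vector_ring. Qed.
Lemma crossmulDl u v w : crossmul (u + v) w = crossmul u w + crossmul v w.
Proof. vector_ring. Qed.
Lemma crossmulZl a u v : crossmul (a *: u) v = a *: crossmul u v.
Proof. vector_ring. Qed.
Lemma crossmulvv u : crossmul u u = 0. Proof. vector_ring. Qed.

Lemma dotmul_crossl u v : dotmul u (crossmul u v) = 0. Proof. vector_ring. Qed.
Lemma dotmul_crossr u v : dotmul v (crossmul u v) = 0. Proof. vector_ring. Qed.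

Lemma double_crossmul u v w :
  crossmul u (crossmul v w) = dotmul u w *: v - dotmul u v *: w.
Proof. vector_ring. Qed.

(** Antisymmetry of the triple product in its last two arguments. *)
Lemma dotmul_crossmulC u v w :
  dotmul (crossmul u v) w = - dotmul (crossmul u w) v.
Proof. vector_ring. Qed.

Lemma lagrange_identity u v :
  dotmul (crossmul u v) (crossmul u v) =
  dotmul u u * dotmul v v - dotmul u v ^+ 2.
Proof. vector_ring. Qed.

Lemma dotmul_ge0 u : 0 <= dotmul u u.
Proof. by rewrite dotmulE -!expr2 !addr_ge0 ?sqr_ge0. Qed.

Lemma sqr_enorm u : enorm u ^+ 2 = dotmul u u.
Proof. exact/sqr_sqrtr/dotmul_ge0. Qed.

Lemma enorm_eq0 u : (enorm u == 0) = (u == 0).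
Proof.
apply/eqP/eqP => [|->]; last first.
  by rewrite /enorm dotmulE !mxE !mul0r !addr0 sqrtr0.
move=> u0; have /eqP : dotmul u u = 0 by rewrite -sqr_enorm u0 expr0n.
rewrite dotmulE -!expr2 !paddr_eq0 ?addr_ge0 ?sqr_ge0 // !sqrf_eq0.
by move=> /andP[/andP[/eqP h0 /eqP h1] /eqP h2]; apply: eq_row3; rewrite mxE.
Qed.

Lemma dotmul_normalized u :
  u != 0 -> dotmul ((enorm u)^-1 *: u) ((enorm u)^-1 *: u) = 1.
Proof.
move=> u0; rewrite dotmulZl dotmulZr -sqr_enorm expr2.
by rewrite mulKf ?mulVf ?enorm_eq0.
Qed.

Section OrthonormalPair.
Variables u v : 'rV[R]_3.
Hypotheses (uu : dotmul u u = 1) (vv : dotmul v v = 1) (uv : dotmul u v = 0).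

Lemma orthonormal_dotmul_cross : dotmul (crossmul u v) (crossmul u v) = 1.
Proof. by rewrite lagrange_identity uu vv uv expr0n mulr1 subr0. Qed.

Lemma orthonormal_crossl : crossmul u (crossmul u v) = - v.
Proof. by rewrite double_crossmul uv uu scale0r scale1r sub0r. Qed.

Lemma orthonormal_crossr : crossmul v (crossmul u v) = u.
Proof. by rewrite double_crossmul vv dotmulC uv scale1r scale0r subr0. Qed.

(* Expand [b x (w x b)], where [b = u x v], in two ways. *)
Lemma orthonormal_expansion w :
  w = dotmul u w *: u + dotmul v w *: v
      + dotmul (crossmul u v) w *: crossmul u v.
Proof.
set b := crossmul u v.
have : crossmul b (crossmul w b) = w - dotmul b w *: b.
  by rewrite double_crossmul orthonormal_dotmul_cross scale1r.
rewrite {1}(double_crossmul w u v) crossmulDr -scaleNr !crossmulZr.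
rewrite (crossmulC b u) (crossmulC b v) orthonormal_crossl orthonormal_crossr.
rewrite opprK scalerN scaleNr opprK (dotmulC w u) (dotmulC w v) => /eqP.
by rewrite eq_sym subr_eq (addrC (_ *: v)) => /eqP.
Qed.

End OrthonormalPair.

End VectorAlgebra.

(** * Derivatives of vector functions of one real variable *)

Section Derivatives.
Variable R : realType.
Implicit Types (s : R) (I : set R).

Lemma is_deriveE (V : normedModType R) (f : R -> V) s (l : V) :
  is_derive s 1 f l <->
  h^-1 *: ((f \o shift s) (h *: (1 : R)) - f s) @[h --> 0^'] --> l.
Proof.
split=> [[fs <-]|fl]; first exact: fs.
split; first exact: (cvgP l).
exact/cvg_lim.
Qed.

(** Coordinate projections are continuous, which gives one direction. Conversely, a ball of the sup
    norm is a product of balls, and the finitely many neighbourhoods obtained from the coordinates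
    intersect in a neighbourhood. The vector product rules below reduce to the scalar one through
    this. *)
Lemma is_derive_rowP n (f : R -> 'rV[R]_n.+1) s (l : 'rV[R]_n.+1) :
  is_derive s 1 f l <->
  forall j, is_derive s 1 (fun x => f x 0 j) (l 0 j).
Proof.
split=> [/is_deriveE fl j|fl]; apply/is_deriveE.
  rewrite [X in X @ _ --> _](_ : _ = (fun M : 'rV[R]_n.+1 => M 0 j) \o
    (fun h : R => h^-1 *: ((f \o shift s) (h *: (1 : R)) - f s))).
    by apply: cvg_comp fl _; exact: coord_continuous.
  by apply/funext => h /=; rewrite !mxE.
apply/cvg_ballP => e e0.
have : \forall h \near (0 : R)^', forall j, ball (l 0 j) e
    (h^-1 *: (f (h *: (1 : R) + s) 0 j - f s 0 j)).
  by apply: filter_forall => j; move: (fl j) => /is_deriveE /cvg_ballP; exact.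
apply: filterS => h hj; split=> // i j.
by rewrite ord1 !mxE; exact: hj.
Qed.

Lemma is_derive_mul (f g : R -> R) s (df dg : R) :
  is_derive s 1 f df -> is_derive s 1 g dg ->
  is_derive s 1 (fun x => f x * g x) (df * g s + f s * dg).
Proof.
move=> hf hg; apply: is_derive_eq; rewrite addrC /GRing.scale /=.
by rewrite (mulrC (g s)).
Qed.

Lemma is_derive_scale n (k : R -> R) (f : R -> 'rV[R]_n.+1) s dk df :
  is_derive s 1 k dk -> is_derive s 1 f df ->
  is_derive s 1 (fun x => k x *: f x) (dk *: f s + k s *: df).
Proof.
move=> hk /is_derive_rowP hf; apply/is_derive_rowP => j.
under eq_fun do rewrite mxE.
by rewrite !mxE; exact: is_derive_mul.
Qed.

Lemma is_derive_dotmul (f g : R -> 'rV[R]_3) s df dg :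
  is_derive s 1 f df -> is_derive s 1 g dg ->
  is_derive s 1 (fun x => dotmul (f x) (g x))
    (dotmul df (g s) + dotmul (f s) dg).
Proof.
move=> /is_derive_rowP hf /is_derive_rowP hg.
under eq_fun do rewrite dotmulE.
have h j := is_derive_mul (hf j) (hg j).
apply: (is_derive_eq (is_deriveD (is_deriveD (h 0) (h 1)) (h 2))).
vector_ring.
Qed.

Lemma is_derive_crossmul (f g : R -> 'rV[R]_3) s df dg :
  is_derive s 1 f df -> is_derive s 1 g dg ->
  is_derive s 1 (fun x => crossmul (f x) (g x))
    (crossmul df (g s) + crossmul (f s) dg).
Proof.
move=> /is_derive_rowP hf /is_derive_rowP hg; apply/is_derive_rowP.
have h i j := is_derive_mul (hf i) (hg j).
by apply: forall_ord3; under eq_fun do rewrite crossmulE;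
  apply: (is_derive_eq (is_deriveB (h _ _) (h _ _))); vector_ring.
Qed.

(** Used to differentiate a constant dot product in two ways: as a constant and by the product
    rule. *)
Lemma is_derive_unique (V : normedModType R) (f : R -> V) s (l l' : V) :
  is_derive s 1 f l -> is_derive s 1 f l' -> l = l'.
Proof. by move=> [_ <-] [_ <-]. Qed.

Lemma is_derive1P (V : normedModType R) (f : R -> V) s :
  derivable f s 1 -> is_derive s 1 f (derive1 f s).
Proof. by rewrite derive1E => /derivableP. Qed.

Lemma is_derive1E (V : normedModType R) (f : R -> V) s l :
  is_derive s 1 f l -> derive1 f s = l.
Proof. by rewrite derive1E => -[]. Qed.

(** An open [I] is a neighbourhood of each of its points. This lets identities known only on [I] be
    differentiated. *)
Lemma eq_on_is_derive (V : normedModType R) I (f g : R -> V) s l :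
  open I -> I s -> {in I, f =1 g} -> is_derive s 1 f l -> is_derive s 1 g l.
Proof.
move=> oI Is fg; apply: near_eq_is_derive.
by apply: filterS (open_nbhs_nbhs (conj oI Is)) => x Ix; apply: fg; rewrite inE.
Qed.

End Derivatives.

(** * Frenet equations of a curve parametrized by arc length *)

Section Frenet.
Variables (R : realType) (I : set R) (alpha : R -> 'rV[R]_3).
Hypotheses (oI : open I) (arc : arclength_frenet_curve I alpha).
Variable s : R.
Hypothesis Is : I s.
Let T := tangent alpha.
Let N := normal alpha.
Let B := binormal alpha.
Let k := curvature alpha.
Let t := torsion alpha.

Let smooth_is_derive n x : I x ->
  is_derive x 1 (derive1n n alpha) (derive1n n.+1 alpha x).
Proof. by move=> Ix; apply: is_derive1P; case: arc => + _ _; exact. Qed.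

Let tangentE x : I x -> T x = derive1 alpha x.
Proof. by case: arc => _ h _ Ix; rewrite /T /tangent h // invr1 scale1r. Qed.

Let is_derive_tangent2 x : I x -> is_derive x 1 T (derive1n 2 alpha x).
Proof.
move=> Ix; apply: eq_on_is_derive oI Ix _ (smooth_is_derive 1 Ix).
by move=> y /[!inE] Iy; rewrite tangentE.
Qed.

Let curvatureE x : I x -> k x = enorm (derive1n 2 alpha x).
Proof.
by move=> Ix; rewrite /k /curvature (is_derive1E (is_derive_tangent2 Ix)).
Qed.

Let curvature_gt0 x : I x -> 0 < k x.
Proof. by case: arc => _ _; exact. Qed.

Let tangent_unit x : I x -> dotmul (T x) (T x) = 1.
Proof.
move=> Ix; rewrite tangentE // -sqr_enorm.
by case: arc => _ -> //; rewrite expr1n.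
Qed.

(** Differentiate the constant <T, T> = 1. *)
Let tangent_orth x : I x -> dotmul (T x) (derive1n 2 alpha x) = 0.
Proof.
move=> Ix; have h := is_derive_tangent2 Ix.
have h1 : is_derive x 1 (fun x => dotmul (T x) (T x)) 0.
  apply: eq_on_is_derive oI Ix _ (is_derive_cst (1 : R) (x : R) 1).
  by move=> y /[!inE] Iy; rewrite tangent_unit.
have := is_derive_unique (is_derive_dotmul h h) h1.
by rewrite dotmulC -mulr2n => /eqP; rewrite mulrn_eq0 => /eqP.
Qed.

(** By the Lagrange identity, the cross product of the unit vector T with the orthogonal vector T'
    has the norm of T', which is the curvature. *)
Let binormal_scale x : I x ->
  B x = (k x)^-1 *: crossmul (T x) (derive1n 2 alpha x).
Proof.
move=> Ix; rewrite /B /binormal -tangentE // curvatureE // /enorm.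
by rewrite lagrange_identity tangent_unit // tangent_orth // expr0n mul1r subr0.
Qed.

(** Reconciles the definition of N as B x T with the classical T' / kappa, by expanding the double
    cross product. *)
Let normalE x : I x -> N x = (k x)^-1 *: derive1n 2 alpha x.
Proof.
move=> Ix; rewrite /N /normal -/B -/T binormal_scale // crossmulZl crossmulC.
rewrite double_crossmul tangent_unit // tangent_orth //.
by rewrite scale0r sub0r opprK scale1r.
Qed.

Lemma is_derive_tangent : is_derive s 1 T (k s *: N s).
Proof.
rewrite normalE // scalerA divff ?gt_eqF ?curvature_gt0 // scale1r.
exact: is_derive_tangent2.
Qed.

Lemma dotmul_tangent : dotmul (T s) (T s) = 1.
Proof. exact: tangent_unit. Qed.

Let normal_unit x : I x -> dotmul (N x) (N x) = 1.
Proof.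
move=> Ix; rewrite normalE // curvatureE // dotmul_normalized //.
by rewrite -enorm_eq0 -curvatureE // gt_eqF // curvature_gt0.
Qed.

Lemma dotmul_normal : dotmul (N s) (N s) = 1.
Proof. exact: normal_unit. Qed.

Let tangent_normal x : I x -> dotmul (T x) (N x) = 0.
Proof. by move=> Ix; rewrite normalE // dotmulZr tangent_orth // mulr0. Qed.

Lemma dotmul_tangent_normal : dotmul (T s) (N s) = 0.
Proof. exact: tangent_normal. Qed.

Let binormal_cross x : I x -> B x = crossmul (T x) (N x).
Proof. by move=> Ix; rewrite binormal_scale // normalE // crossmulZr. Qed.

Lemma binormalE : B s = crossmul (T s) (N s).
Proof. exact: binormal_cross. Qed.

(** Near [s] the curvature is the square root of <alpha'', alpha''>, and the radicand is positive,
    so the square root is differentiable there. *)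
Lemma derivable_curvature : derivable k s 1.
Proof.
have h := smooth_is_derive 2 Is.
have k2 : 0 < dotmul (derive1n 2 alpha s) (derive1n 2 alpha s).
  by rewrite -sqr_enorm -curvatureE // exprn_gt0 // curvature_gt0.
have hd := is_derive1_comp (is_derive1_sqrt k2) (is_derive_dotmul h h).
have [] // := eq_on_is_derive (g := k) oI Is _ hd.
by move=> y /[!inE] Iy; rewrite curvatureE.
Qed.

Let derivable_normal : derivable N s 1.
Proof.
have kV : is_derive s 1 (fun x => (k x)^-1) _ :=
  is_deriveV (lt0r_neq0 (curvature_gt0 Is)) (is_derive1P derivable_curvature).
have [] // := eq_on_is_derive (g := N) oI Is _
  (is_derive_scale kV (smooth_is_derive 2 Is)).
by move=> y /[!inE] Iy; rewrite normalE.
Qed.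

Let N' := derive1 N s.

Let is_derive_normal' : is_derive s 1 N N'.
Proof. exact: is_derive1P derivable_normal. Qed.

(** Differentiate B = T x N; the term T' x N vanishes because T' is parallel to N. *)
Let is_derive_binormal' : is_derive s 1 B (crossmul (T s) N').
Proof.
have := is_derive_crossmul is_derive_tangent is_derive_normal'.
rewrite crossmulZl crossmulvv scaler0 add0r.
apply: eq_on_is_derive oI Is _.
by move=> y /[!inE] Iy; rewrite binormal_cross.
Qed.

(** Expand N' in the frame. Differentiating <N, N> = 1 and <T, N> = 0 gives the coefficients on N
    and T; the one on B is the torsion. *)
Let derive_normalE : N' = - k s *: T s + t s *: B s.
Proof.
rewrite [LHS](orthonormal_expansion dotmul_tangent dotmul_normal
  dotmul_tangent_normal).
have -> : dotmul (N s) N' = 0.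
  have h1 : is_derive s 1 (fun x => dotmul (N x) (N x)) 0.
    apply: eq_on_is_derive oI Is _ (is_derive_cst (1 : R) (s : R) 1).
    by move=> y /[!inE] Iy; rewrite normal_unit.
  have := is_derive_unique
    (is_derive_dotmul is_derive_normal' is_derive_normal') h1.
  by rewrite dotmulC -mulr2n => /eqP; rewrite mulrn_eq0 => /eqP.
have -> : dotmul (T s) N' = - k s.
  have h1 : is_derive s 1 (fun x => dotmul (T x) (N x)) 0.
    apply: eq_on_is_derive oI Is _ (is_derive_cst (0 : R) (s : R) 1).
    by move=> y /[!inE] Iy; rewrite tangent_normal.
  have := is_derive_unique
    (is_derive_dotmul is_derive_tangent is_derive_normal') h1.
  rewrite dotmulZl dotmul_normal mulr1 => /eqP.
  by rewrite addr_eq0 => /eqP ->; rewrite opprK.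
rewrite scale0r addr0 -binormalE; congr (_ + _ *: _).
(* The torsion is defined through B' = T x N', so both sides are the same triple product up to a
   transposition. *)
rewrite /t /torsion (is_derive1E is_derive_binormal').
by rewrite binormalE dotmul_crossmulC.
Qed.

Lemma is_derive_normal : is_derive s 1 N (- k s *: T s + t s *: B s).
Proof. by rewrite -derive_normalE. Qed.

(** Insert N' = - kappa T + tau B into B' = T x N' and use T x B = - N. *)
Lemma is_derive_binormal : is_derive s 1 B (- t s *: N s).
Proof.
have := is_derive_binormal'.
rewrite derive_normalE binormalE.
rewrite crossmulDr (crossmulZr (- k s)) (crossmulZr (t s)).
rewrite crossmulvv scaler0 add0r.
rewrite (orthonormal_crossl dotmul_tangent dotmul_tangent_normal).
by rewrite (scalerN (t s)) -scaleNr.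
Qed.

End Frenet.

(** * Frenet frame of a regular curve with arbitrary parameter *)

Section RegularFrame.
Variables (R : realType) (beta : R -> 'rV[R]_3) (s : R).
Hypothesis dbeta : derive1 beta s != 0.
Hypothesis cbeta : crossmul (derive1 beta s) (derive1n 2 beta s) != 0.

Lemma derive_tangentE :
  derive1 beta s = enorm (derive1 beta s) *: tangent beta s.
Proof. by rewrite scalerA divff ?scale1r // enorm_eq0. Qed.

Lemma dotmul_tangent_regular : dotmul (tangent beta s) (tangent beta s) = 1.
Proof. exact: dotmul_normalized. Qed.

Lemma dotmul_binormal_regular : dotmul (binormal beta s) (binormal beta s) = 1.
Proof. exact: dotmul_normalized. Qed.

Lemma dotmul_binormal_tangent : dotmul (binormal beta s) (tangent beta s) = 0.
Proof.
by rewrite /binormal /tangent dotmulZl dotmulZr dotmulC dotmul_crossl !mulr0.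
Qed.

Lemma dotmul_normal_tangent : dotmul (normal beta s) (tangent beta s) = 0.
Proof. by rewrite dotmulC dotmul_crossr. Qed.

Lemma dotmul_normal_binormal : dotmul (normal beta s) (binormal beta s) = 0.
Proof. by rewrite dotmulC dotmul_crossl. Qed.

(** Together with [crossmul_tangent_normal]: taking the cross product with T* on the left is a
    quarter turn of the normal plane, which is what allows N = P* to be solved for N*. *)
Lemma crossmul_tangent_binormal :
  crossmul (tangent beta s) (binormal beta s) = - normal beta s.
Proof. by rewrite crossmulC. Qed.

Lemma crossmul_tangent_normal :
  crossmul (tangent beta s) (normal beta s) = binormal beta s.
Proof.
rewrite /normal double_crossmul dotmul_tangent_regular dotmulC.
by rewrite dotmul_binormal_tangent scale0r subr0 scale1r.
Qed.

End RegularFrame.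

(** * First derivative, tangent and normal of the associated curve *)

Section Associated.
Variables (R : realType) (I : set R) (c d : R).
Variables (alpha beta : R -> 'rV[R]_3) (lam : R -> R).
Hypotheses (oI : open I) (hcd : ~ (c = 0 /\ d = 0)).
Hypotheses (arc : arclength_frenet_curve I alpha).
Hypotheses (assoc : NP_associated I c d alpha lam beta).
Let T := tangent alpha.
Let N := normal alpha.
Let B := binormal alpha.
Let k := curvature alpha.
Let t := torsion alpha.

Let rho := Num.sqrt (c ^+ 2 + d ^+ 2).

Let sqr_rho : rho ^+ 2 = c ^+ 2 + d ^+ 2.
Proof. by rewrite sqr_sqrtr // addr_ge0 ?sqr_ge0. Qed.

Let rho_neq0 : rho != 0.
Proof.
apply/eqP => r0; apply: hcd.
have /eqP : c ^+ 2 + d ^+ 2 = 0 by rewrite -sqr_rho r0 expr0n.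
by rewrite paddr_eq0 ?sqr_ge0 // !sqrf_eq0 => /andP[/eqP -> /eqP ->].
Qed.

Let associated_neq0 x : I x ->
  derive1 beta x != 0 /\ crossmul (derive1 beta x) (derive1n 2 beta x) != 0.
Proof. by case: assoc => _ [_ h1 h2] _ _ Ix; split; [exact: h1|exact: h2]. Qed.

Let normal_alphaE x : I x ->
  N x = rho^-1 *: (c *: normal beta x + d *: binormal beta x).
Proof. by case: assoc => _ _ _; exact. Qed.

Let orth x : I x -> dotmul (N x) (derive1 beta x) = 0.
Proof.
move=> Ix; have [db cb] := associated_neq0 Ix.
rewrite derive_tangentE // normal_alphaE // dotmulZr dotmulZl dotmulDl.
rewrite (dotmulZl c) (dotmulZl d).
by rewrite dotmul_binormal_tangent dotmul_normal_tangent !(mulr0, addr0).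
Qed.

(** The product rule for [alpha + lam N] with the Frenet formula for N'. The term in lambda' stays
    until [derive_lam] shows that it vanishes. *)
Let is_derive_beta_lam x : I x ->
  is_derive x 1 beta ((1 - lam x * k x) *: T x + derive1 lam x *: N x
                      + (lam x * t x) *: B x).
Proof.
case: assoc => lamS _ betaE _ Ix.
have lamD : is_derive x 1 lam (derive1 lam x) := is_derive1P (lamS 0%N x Ix).
have alphaD : is_derive x 1 alpha (T x).
  case: arc => /(_ 0%N x Ix) /is_derive1P /= h u _.
  by rewrite /T /tangent u // invr1 scale1r.
have h := is_deriveD alphaD (is_derive_scale lamD (is_derive_normal oI arc Ix)).
apply: is_derive_eq.
  apply: eq_on_is_derive oI Ix _ h.
  by move=> y /[!inE] Iy; rewrite betaE.
rewrite -/T -/N -/B -/k -/t.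
by move: (T x) (N x) (B x) => u v w; vector_ring.
Qed.

(** This and the following facts are the multiplication table of the frame. Later proofs generalize
    [T x], [N x], [B x] to arbitrary vectors, so that the frame enters the computations only through
    this table. *)
Let TT x : I x -> dotmul (T x) (T x) = 1.
Proof. by move=> Ix; exact (dotmul_tangent arc Ix). Qed.
Let NN x : I x -> dotmul (N x) (N x) = 1.
Proof. by move=> Ix; exact (dotmul_normal oI arc Ix). Qed.
Let TN x : I x -> dotmul (T x) (N x) = 0.
Proof. by move=> Ix; exact (dotmul_tangent_normal oI arc Ix). Qed.
Let BE x : I x -> B x = crossmul (T x) (N x).
Proof. by move=> Ix; exact (binormalE oI arc Ix). Qed.
Let BB x : I x -> dotmul (B x) (B x) = 1.
Proof. by move=> Ix; rewrite BE // orthonormal_dotmul_cross ?TT ?NN ?TN. Qed.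
Let TB x : I x -> dotmul (T x) (B x) = 0.
Proof. by move=> Ix; rewrite BE // dotmul_crossl. Qed.
Let NB x : I x -> dotmul (N x) (B x) = 0.
Proof. by move=> Ix; rewrite BE // dotmul_crossr. Qed.
Let BxT x : I x -> crossmul (B x) (T x) = N x.
Proof.
by move=> Ix; rewrite crossmulC BE // orthonormal_crossl ?opprK ?TT ?TN.
Qed.
Let NxB x : I x -> crossmul (N x) (B x) = T x.
Proof. by move=> Ix; rewrite BE // orthonormal_crossr ?NN ?TN. Qed.

Let derive_lam x : I x -> derive1 lam x = 0.
Proof.
move=> Ix; have := orth Ix; rewrite (is_derive1E (is_derive_beta_lam Ix)).
move: (NN Ix) (TN Ix) (NB Ix); move: (T x) (N x) (B x) => u v w vv uv vw.
rewrite !dotmulDr !dotmulZr (dotmulC v u) vv uv vw.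
by rewrite !(mulr0, mulr1, add0r, addr0).
Qed.

(** Stated at every point of [I], since [derive2_associated] differentiates it. *)
Lemma derive_associated x : I x ->
  derive1 beta x = (1 - lam x * k x) *: T x + (lam x * t x) *: B x.
Proof.
move=> Ix; rewrite (is_derive1E (is_derive_beta_lam Ix)) derive_lam //.
by rewrite scale0r addr0.
Qed.

Variable s : R.
Hypothesis Is : I s.

Let r := Num.sqrt ((1 - lam s * k s) ^+ 2 + (lam s * t s) ^+ 2).

Lemma enorm_derive_associated : enorm (derive1 beta s) = r.
Proof.
rewrite /enorm derive_associated //; congr Num.sqrt.
move: (TT Is) (BB Is) (TB Is); move: (T s) (B s) => u w uu ww uw.
by rewrite !(dotmulDl, dotmulDr, dotmulZl, dotmulZr) (dotmulC w) uu ww uw; ring.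
Qed.

Lemma tangent_associated : tangent beta s =
  ((1 - lam s * k s) / r) *: T s + (lam s * t s / r) *: B s.
Proof.
rewrite /tangent enorm_derive_associated derive_associated //.
by rewrite scalerDr !scalerA ![r^-1 * _]mulrC.
Qed.

Lemma normal_associated : normal beta s =
  rho^-1 *: ((d * lam s * t s / r) *: T s + c *: N s
             - (d * (1 - lam s * k s) / r) *: B s).
Proof.
have [db cb] := associated_neq0 Is.
have TxN : crossmul (tangent beta s) (N s) =
    rho^-1 *: (c *: binormal beta s - d *: normal beta s).
  rewrite normal_alphaE // crossmulZr crossmulDr (crossmulZr c) (crossmulZr d).
  by rewrite crossmul_tangent_normal // crossmul_tangent_binormal (scalerN d).
have nE : normal beta s =
    rho^-1 *: (c *: N s - d *: crossmul (tangent beta s) (N s)).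
  rewrite TxN normal_alphaE // -[LHS]scale1r.
  (* Written this way, the identity becomes polynomial in [rho^-1], [c] and [d], within reach of
     [ring]. *)
  have -> : 1 = rho^-1 * (rho^-1 * (c ^+ 2 + d ^+ 2)).
    by rewrite -sqr_rho expr2 mulKf // mulVf.
  by move: (normal beta s) (binormal beta s) => u v; vector_ring.
rewrite nE tangent_associated.
move: (BE Is) (NxB Is); move: (T s) (N s) (B s) => u v w wE vw.
rewrite crossmulDl !crossmulZl -wE (crossmulC w) vw.
vector_ring.
Qed.

(** * Second derivative and binormal of the associated curve *)

Let k' := derive1 k s.
Let t' := derive1 t s.

(* [lam * torsion = B . beta'] near [s], and [lam s != 0]. *)
Lemma derivable_torsion : lam s != 0 -> derivable t s 1.
Proof.
case: (assoc) => lamS [betaS _ _] _ _ lam0.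
have lamD : is_derive s 1 lam (derive1 lam s) := is_derive1P (lamS 0%N s Is).
have betaD := is_derive1P (betaS 1%N s Is).
have := is_derive_mul (is_derive_dotmul (is_derive_binormal oI arc Is) betaD)
  (is_deriveV lam0 lamD).
set l := (X in is_derive _ _ _ X) => h.
suff tD : is_derive s 1 t l by case: tD.
apply: near_eq_is_derive _ h.
have lamC : {for s, continuous lam}.
  by apply/differentiable_continuous/derivable1_diffP; case: lamD.
have lamN0 : \forall x \near s, lam x != 0 by exact: cvgr_neq0 lamC lam0.
near=> x.
have Ix : I x by near: x; exact: open_nbhs_nbhs.
have l0 : lam x != 0 by near: x.
rewrite /= derive_associated // -/B.
move: (TB Ix) (BB Ix); move: (T x) (B x) => u w uw ww.
rewrite dotmulDr !dotmulZr (dotmulC w u) uw ww mulr0 add0r mulr1.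
by rewrite mulrAC divff ?mul1r.
Unshelve. all: by end_near. Qed.

(** Differentiate [derive_associated] by the product rule and the Frenet equations, with lambda' =
    0. The hypothesis on [lam s] makes the torsion derivable. *)
Lemma derive2_associated : lam s != 0 ->
  derive1n 2 beta s =
  (- (lam s * k')) *: T s
  + (k s - lam s * k s ^+ 2 - lam s * t s ^+ 2) *: N s
  + (lam s * t') *: B s.
Proof.
case: (assoc) => lamS _ _ _ lam0.
have lamD : is_derive s 1 lam 0.
  by rewrite -(derive_lam Is); exact: is_derive1P (lamS 0%N s Is).
have kD := is_derive1P (derivable_curvature oI arc Is).
have tD := is_derive1P (derivable_torsion lam0).
have aD : is_derive s 1 (fun x => 1 - lam x * k x) (0 - (0 * k s + lam s * k')).
  exact: is_deriveB (is_derive_cst (1 : R) (s : R) 1) (is_derive_mul lamD kD).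
have h := is_deriveD (is_derive_scale aD (is_derive_tangent oI arc Is))
  (is_derive_scale (is_derive_mul lamD tD) (is_derive_binormal oI arc Is)).
apply: is_derive1E.
apply: is_derive_eq.
  apply: eq_on_is_derive oI Is _ h.
  by move=> y /[!inE] Iy; rewrite derive_associated.
rewrite -/T -/N -/B -/k -/t -/k' -/t' /=.
by move: (T s) (N s) (B s) => u v w; vector_ring.
Qed.

Lemma binormal_associated :
  lam s * t s * k' - k s * t' * lam s + t' != 0 -> lam s != 0 ->
  binormal beta s =
    (d / rho) *:
      (- (t s * (lam s * t s ^+ 2 + k s ^+ 2 * lam s - k s)
           / (lam s * t s * k' - k s * t' * lam s + t')) *: T s
       + N s
       + ((lam s * k s - 1) * (lam s * t s ^+ 2 + k s ^+ 2 * lam s - k s)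
           / (lam s * (- (lam s * t s * k') + k s * t' * lam s - t'))) *: B s).
Proof.
move=> D0 lam0.
(* [a] and [b] are the coefficients of beta' on T and B, [y] is that of beta'' on N, and [w] will be
   that of beta' x beta'' on N. Up to sign, [w] is [lam s] times the first denominator; it equals
   the second one. *)
set a := 1 - lam s * k s; set b := lam s * t s.
set y := k s - lam s * k s ^+ 2 - lam s * t s ^+ 2.
set w := - (lam s * (lam s * t s * k' - k s * t' * lam s + t')).
have w0 : w != 0 by rewrite oppr_eq0 mulf_neq0.
have CE : crossmul (derive1 beta s) (derive1n 2 beta s) =
    (- (b * y)) *: T s + w *: N s + (a * y) *: B s.
  rewrite derive_associated // derive2_associated // -/a -/b -/y.
  move: (BE Is) (BxT Is) (NxB Is); move: (T s) (N s) (B s) => u v z zE zu vz.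
  rewrite !(crossmulDl, crossmulDr, crossmulZl, crossmulZr) !crossmulvv -zE zu.
  rewrite (crossmulC z v) vz (crossmulC u z) zu /w /a /b.
  vector_ring.
set M := enorm (crossmul (derive1 beta s) (derive1n 2 beta s)).
have bE : binormal beta s =
    M^-1 *: ((- (b * y)) *: T s + w *: N s + (a * y) *: B s).
  by rewrite -CE.
have Nb : dotmul (N s) (binormal beta s) = d / rho.
  have [_ cb] := associated_neq0 Is.
  rewrite normal_alphaE // dotmulZl dotmulDl (dotmulZl c) (dotmulZl d).
  rewrite dotmul_binormal_regular //.
  by rewrite dotmul_normal_binormal mulr0 add0r mulr1 mulrC.
(* Pairing B* with N isolates [w / M], while N = P* gives [d / rho] for the same product. This fixes
   the factor, sign included, without computing the norm [M]. *)
have Mw : M^-1 = d / rho / w.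
  rewrite -Nb bE; move: (NN Is) (TN Is) (NB Is).
  move: (T s) (N s) (B s) => u v z vv uv vz.
  rewrite dotmulZr !dotmulDr !dotmulZr (dotmulC v u) vv uv vz.
  by rewrite !mulr0 addr0 add0r mulr1 mulfK.
rewrite bE Mw -(scalerA (d / rho)); congr (_ *: _).
move: (T s) (N s) (B s) => u v z.
rewrite !scalerDr !scalerA mulVf // scale1r; congr (_ *: _ + _ + _ *: _).
- by rewrite /w /b /y; field; rewrite D0 lam0.
(* This factor of the second denominator is the opposite of the expression in [D0]. *)
- have D0' : - (b * k') + k s * t' * lam s - t' != 0.
    by rewrite -oppr_eq0 !opprD !opprK.
  by rewrite /w /a /y /b; field; do ?[apply/andP; split].
Qed.

End Associated.

Unset Implicit Arguments.
Set Strict Implicit.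

Theorem theorem4p3 (R : realType) (I : set R) (c d : R)
    (alpha beta : R -> 'rV[R]_3) (lam : R -> R)
    (hI : open_interval I)
    (hcd : ~ (c = 0 /\ d = 0))
    (halpha : arclength_frenet_curve I alpha)
    (hbeta : NP_associated I c d alpha lam beta)
    (s : R) (hs : I s) :
  let T := tangent alpha s in
  let N := normal alpha s in
  let B := binormal alpha s in
  let k := curvature alpha s in
  let t := torsion alpha s in
  let k' := derive1 (curvature alpha) s in
  let t' := derive1 (torsion alpha) s in
  let l := lam s in
  let r := Num.sqrt ((1 - l * k) ^+ 2 + (l * t) ^+ 2) in
  [/\ tangent beta s = ((1 - l * k) / r) *: T + (l * t / r) *: B,
      normal beta s =
        (Num.sqrt (c ^+ 2 + d ^+ 2))^-1 *:
          ((d * l * t / r) *: T + c *: N - (d * (1 - l * k) / r) *: B) &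
      l * t * k' - k * t' * l + t' != 0 ->
      l * (- (l * t * k') + k * t' * l - t') != 0 ->
      binormal beta s =
        (d / Num.sqrt (c ^+ 2 + d ^+ 2)) *:
          (- (t * (l * t ^+ 2 + k ^+ 2 * l - k)
               / (l * t * k' - k * t' * l + t')) *: T
           + N
           + ((l * k - 1) * (l * t ^+ 2 + k ^+ 2 * l - k)
               / (l * (- (l * t * k') + k * t' * l - t'))) *: B)].
Proof.
case: hI => oI _ _.
split.
- exact (tangent_associated oI halpha hbeta hs).
- exact (normal_associated oI hcd halpha hbeta hs).
(* The second denominator has [lam s] as a factor, so its nonvanishing provides [lam s != 0]. *)
- move=> D0; rewrite mulf_eq0 negb_or => /andP[lam0 _].
  exact (binormal_associated oI halpha hbeta hs D0 lam0).
Qed.
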